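(* Let $A$ be an algebra, with left and right multiplication operators $L,R:A\to\mathrm{End}(A)$. Then there exists a bilinear form $B_A:A\times A\to\mathbb{K}$ such that $(A,B_A)$ is a quadratic algebra if and only if $(A,R,L)$ and $(A^*,R^*,L^* )$ are isomorphic $A$-bimodules.
   Context: All vector spaces are finite-dimensional over a field $\mathbb{K}$ of characteristic zero. An algebra is a vector space with a bilinear product (not necessarily associative; no identity is imposed). $L_x(y)=xy$ and $R_x(y)=yx$. On the dual space $A^*$, the maps $L^*,R^*:A\to\mathrm{End}(A^* )$ are defined by $L^*_x(f)=f\circ R_x$ and $R^*_x(f)=f\circ L_x$. $(A,B_A)$ is quadratic if $B_A$ is symmetric, non-degenerate and invariant, i.e. $B_A(xy,z)=B_A(x,yz)$ for all $x,y,z\in A$. For linear maps $r_i,l_i:A\to\mathrm{End}(V_i)$ ($i=1,2$), an isomorphism of $A$-bimodules $(V_1,r_1,l_1)\to(V_2,r_2,l_2)$ is a linear bijection $\Phi:V_1\to V_2$ with $\Phi(r_1(x)(v))=r_2(x)(\Phi(v))$ and $\Phi(l_1(x)(v))=l_2(x)(\Phi(v))$ for all $x\in A$, $v\in V_1$. Since $A$ is an arbitrary algebra with no identity imposed, being an $A$-bimodule imposes no further condition on $(V,r,l)$. *)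

(* Defs.v *)
From HB Require Import structures.
From mathcomp Require Import all_boot all_order all_algebra.

Set Implicit Arguments.
Unset Strict Implicit.
Unset Printing Implicit Defensive.

Import GRing.Theory.
Local Open Scope ring_scope.

Section MultiplicationOperators.

Variables (K : fieldType) (A : vectType K) (mul : {bilinear A -> A -> A}).

Definition Lmul (x : A) : 'End(A) := linfun (mul x).

Definition Rmul (x : A) : 'End(A) := linfun (mul^~ x).

Lemma LmulE x y : Lmul x y = mul x y.
Proof. by rewrite lfunE. Qed.

Lemma RmulE x y : Rmul x y = mul y x.
Proof. exact: (lfunE (applyr mul x)). Qed.

Fact Lmul_is_linear : linear Lmul.
Proof.
move=> a x y; apply/lfunP => z.
by rewrite add_lfunE scale_lfunE !LmulE linearPl.
Qed.

HB.instance Definition _ :=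
  GRing.isLinear.Build K A 'End(A) _ Lmul Lmul_is_linear.

Fact Rmul_is_linear : linear Rmul.
Proof.
move=> a x y; apply/lfunP => z.
by rewrite add_lfunE scale_lfunE !RmulE linearPr.
Qed.

HB.instance Definition _ :=
  GRing.isLinear.Build K A 'End(A) _ Rmul Rmul_is_linear.

(* The dual space of A is 'Hom(A, K^o). *)
Definition precomp (g : 'End(A)) (f : 'Hom(A, K^o)) : 'Hom(A, K^o) :=
  (f \o g)%VF.

Fact precomp_is_linear g : linear (precomp g).
Proof. by move=> a f h; rewrite /precomp comp_lfunDl comp_lfunZl. Qed.

HB.instance Definition _ g :=
  GRing.isLinear.Build K 'Hom(A, K^o) 'Hom(A, K^o) _ (precomp g)
    (precomp_is_linear g).

(* The left (right) dual operator is the transpose of the right (left) one. *)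
Definition Lstar (x : A) : 'End('Hom(A, K^o)) := linfun (precomp (Rmul x)).

Definition Rstar (x : A) : 'End('Hom(A, K^o)) := linfun (precomp (Lmul x)).

Lemma LstarE x f : Lstar x f = (f \o Rmul x)%VF.
Proof. by rewrite lfunE. Qed.

Lemma RstarE x f : Rstar x f = (f \o Lmul x)%VF.
Proof. by rewrite lfunE. Qed.

Fact Lstar_is_linear : linear Lstar.
Proof.
move=> a x y; apply/lfunP => f.
by rewrite add_lfunE scale_lfunE !LstarE linearP comp_lfunDr comp_lfunZr.
Qed.

HB.instance Definition _ :=
  GRing.isLinear.Build K A 'End('Hom(A, K^o)) _ Lstar Lstar_is_linear.

Fact Rstar_is_linear : linear Rstar.
Proof.
move=> a x y; apply/lfunP => f.
by rewrite add_lfunE scale_lfunE !RstarE linearP comp_lfunDr comp_lfunZr.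
Qed.

HB.instance Definition _ :=
  GRing.isLinear.Build K A 'End('Hom(A, K^o)) _ Rstar Rstar_is_linear.

End MultiplicationOperators.

(* By symmetry, non-degeneracy on the left is also non-degeneracy on the
   right. *)
Definition quadratic (K : fieldType) (A : vectType K)
    (mul : {bilinear A -> A -> A})
    (B : {bilinear A -> A -> K | *%R & *%R}) : Prop :=
  [/\ forall x y, B x y = B y x,
      forall x, (forall y, B x y = 0) -> x = 0
    & forall x y z, B (mul x y) z = B x (mul y z)].

(* For an arbitrary algebra A, the bimodule structures on V are all the pairs
   (r, l) of linear maps from A to 'End(V), with no compatibility axiom;
   hence the product of A does not occur here. *)
Definition bimodule_isomorphic (K : fieldType) (A V1 V2 : vectType K)
    (r1 l1 : {linear A -> 'End(V1)}) (r2 l2 : {linear A -> 'End(V2)}) : Prop :=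
  exists Phi : 'Hom(V1, V2),
    [/\ bijective Phi,
        forall x v, Phi (r1 x v) = r2 x (Phi v)
      & forall x v, Phi (l1 x v) = l2 x (Phi v)].

(* Main.v *)
(** An isomorphism A -> A^* of bimodules is the same thing as a non-degenerate
    form b such that both b and its transpose are invariant, hence so are the
    symmetric part s and the skew part w of b.  Moving factors cyclically around
    w (xy) z three times flips its sign, so w (xy) z = 0 in characteristic not 2
    and all products lie in the radical V of w.  As b = (s + w) / 2 is
    non-degenerate, V meets the radical N of s trivially; completing s by a
    non-degenerate symmetric form on N, extended by zero on a complement of N
    containing V, keeps it invariant because it is unchanged on V x A. *)
Require Import Defs.
From HB Require Import structures.
From mathcomp Require Import all_boot all_order all_algebra.

Set Implicit Arguments.
Unset Strict Implicit.
Unset Printing Implicit Defensive.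

Import GRing.Theory.
Local Open Scope ring_scope.

Section BilinearForms.

Variables (K : fieldType) (A : vectType K).
Implicit Types (b : {biscalar A}) (x y : A) (V : {vspace A}).

(** The codomain is [K^o], a vector space over [K], so that [linfun] can pack [b x] into the dual
    space. *)
Definition form_at b x : A -> K^o := b x.

Fact form_at_is_linear b x : linear (form_at b x).
Proof. by move=> a y z; rewrite /form_at linearPr. Qed.

HB.instance Definition _ b x :=
  GRing.isLinear.Build K A K^o _ (form_at b x) (form_at_is_linear b x).

Definition form_dual b x : 'Hom(A, K^o) := linfun (form_at b x).

Lemma form_dualE b x y : form_dual b x y = b x y.
Proof. by rewrite lfunE. Qed.

Fact form_dual_is_linear b : linear (form_dual b).
Proof.
move=> a x y; apply/lfunP => z.
by rewrite add_lfunE scale_lfunE !form_dualE linearPl.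
Qed.

HB.instance Definition _ b :=
  GRing.isLinear.Build K A 'Hom(A, K^o) _ (form_dual b) (form_dual_is_linear b).

Definition left_radical b : {vspace A} := lker (linfun (form_dual b)).

Lemma left_radicalP b x :
  reflect (forall y, b x y = 0) (x \in left_radical b).
Proof.
rewrite memv_ker lfunE; apply: (iffP eqP) => [bx0 y | bx0].
  by rewrite -form_dualE bx0 zero_lfunE.
by apply/lfunP => y; rewrite form_dualE zero_lfunE.
Qed.

Definition sym_form b x y : K := b x y + b y x.

Fact sym_form_is_biscalar b : bilinear_for *%R *%R (sym_form b).
Proof.
split=> [y a u v | x a u v];
  by rewrite /sym_form /= linearPl linearPr /= mulrDr addrACA.
Qed.

HB.instance Definition _ b :=
  bilinear_isBilinear.Build K A A K _ _ (sym_form b) (sym_form_is_biscalar b).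

Definition skew_form b x y : K := b x y - b y x.

Fact skew_form_is_biscalar b : bilinear_for *%R *%R (skew_form b).
Proof.
split=> [y a u v | x a u v];
  by rewrite /skew_form /= linearPl linearPr /= mulrBr opprD addrACA.
Qed.

HB.instance Definition _ b :=
  bilinear_isBilinear.Build K A A K _ _ (skew_form b) (skew_form_is_biscalar b).

Definition lfun_form (Phi : 'Hom(A, 'Hom(A, K^o))) x y : K := Phi x y.

Fact lfun_form_is_biscalar Phi : bilinear_for *%R *%R (lfun_form Phi).
Proof.
split=> [y a u v | x a u v]; rewrite /lfun_form linearP //.
by rewrite add_lfunE scale_lfunE.
Qed.

HB.instance Definition _ Phi :=
  bilinear_isBilinear.Build K A A K _ _ (lfun_form Phi)
    (lfun_form_is_biscalar Phi).

Definition add_squares b n (f : 'I_n -> 'Hom(A, K^o)) x y : K :=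
  b x y + \sum_i f i x * f i y.

Fact add_squares_is_biscalar b n (f : 'I_n -> 'Hom(A, K^o)) :
  bilinear_for *%R *%R (add_squares b f).
Proof.
split=> [y a u v | x a u v]; rewrite /add_squares /= ?linearPl ?linearPr /= mulrDr;
  rewrite addrACA mulr_sumr -big_split; congr (_ + _);
  apply: eq_bigr => i _; rewrite linearP /=.
  by rewrite mulrDl mulrA.
by rewrite mulrDr mulrCA.
Qed.

HB.instance Definition _ b n (f : 'I_n -> 'Hom(A, K^o)) :=
  bilinear_isBilinear.Build K A A K _ _ (add_squares b f)
    (add_squares_is_biscalar b f).

(** The dot product in coordinates on the radical is non-degenerate over any field; pulled back
    along a projection that kills [V], it repairs [b] without touching it on [V]. *)
Lemma nondegenerate_completion b V :
    (forall x y, b x y = b y x) -> (left_radical b :&: V = 0)%VS ->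
  exists B : {biscalar A},
    [/\ forall x y, B x y = B y x,
        forall x, (forall y, B x y = 0) -> x = 0
      & {in V, forall x y, B x y = b x y}].
Proof.
move=> bC NV0; set N := left_radical b in NV0 *.
(* First drop a complement of [N + V], then take the [N]-component in that sum, which is direct by
   [NV0]. *)
pose p := (daddv_pi N V \o projv (N + V))%VF.
have pN x : p x \in N by rewrite comp_lfunE memv_pi.
have p_id x : x \in N -> p x = x.
  move=> xN; rewrite comp_lfunE projv_id ?daddv_pi_id //.
  exact: subvP (addvSl _ _) _ xN.
have p0 x : x \in V -> p x = 0.
  move=> xV; have xNV : x \in (N + V)%VS by apply: subvP (addvSr _ _) _ xV.
  (* [x] is its own [V]-component, so its [N]-component is zero. *)
  rewrite comp_lfunE projv_id //; apply: (addIr x); rewrite add0r.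
  rewrite -[in RHS](daddv_pi_add NV0 xNV); congr (_ + _).
  by rewrite daddv_pi_id // capvC.
pose f i : 'Hom(A, K^o) := (linfun (coord (vbasis N) i : A -> K^o) \o p)%VF.
have fE i x : f i x = coord (vbasis N) i (p x) by rewrite comp_lfunE lfunE.
exists (add_squares b f); split=> [x y | x Bx0 | x xV y]; rewrite /= /add_squares.
- by rewrite bC; congr (_ + _); apply: eq_bigr => i _; rewrite mulrC.
- have px0 : p x = 0.
    rewrite (coord_vbasis (pN x)) big1 // => i _.
    have eN : (vbasis N)`_i \in N by rewrite vbasis_mem ?mem_nth ?size_tuple.
    (* Pairing with a basis vector of [N] kills the [b] term and leaves the [i]-th coordinate of
       [p x]. *)
    have := Bx0 (vbasis N)`_i; rewrite /= /add_squares bC.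
    rewrite (left_radicalP _ _ eN) add0r (bigD1 i) //= big1 => [|j ji].
      rewrite addr0 !fE (p_id _ eN) coord_free ?(basis_free (vbasisP N)) //.
      by rewrite eqxx mulr1 => ->; rewrite scale0r.
    rewrite !fE (p_id _ eN) coord_free ?(basis_free (vbasisP N)) //.
    by rewrite eq_sym (negPf ji) mulr0.
  (* With [p x = 0] the added squares vanish at [x], so [x] lies in [N], where [p] is the
     identity. *)
  rewrite -(p_id x) //; apply/left_radicalP => y; rewrite -(Bx0 y) /= /add_squares.
  by rewrite big1 ?addr0 // => i _; rewrite fE px0 linear0 mul0r.
by rewrite big1 ?addr0 // => i _; rewrite fE p0 // linear0 mul0r.
Qed.

End BilinearForms.

Section InvariantForms.

Variables (K : fieldType) (A : vectType K) (mul : {bilinear A -> A -> A}).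
Implicit Type b : {biscalar A}.

(** The two identities express that [b], as a map to the dual, intertwines [R] with [R^*] and [L]
    with [L^*]; the second is invariance of the transpose of [b]. *)
Lemma quadratic_of_biinvariant b :
    2%:R != 0 :> K ->
    (forall x, (forall y, b x y = 0) -> x = 0) ->
    (forall x y z, b (mul x y) z = b x (mul y z)) ->
    (forall x y z, b (mul x y) z = b y (mul z x)) ->
  exists B : {biscalar A}, quadratic mul B.
Proof.
move=> K2 b_ndeg bR bL.
have two0 (t : K) : t + t = 0 -> t = 0.
  by rewrite -mulr2n -mulr_natr => /eqP; rewrite mulf_eq0 (negPf K2) orbF => /eqP.
have bT x y z : b z (mul x y) = b (mul y z) x by rewrite bL.
pose s : {biscalar A} := sym_form b; pose w : {biscalar A} := skew_form b.
have sC x y : s x y = s y x by rewrite /= /sym_form addrC.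
have sI x y z : s (mul x y) z = s x (mul y z).
  by rewrite /= /sym_form bR (bT x).
have wI x y z : w (mul x y) z = w x (mul y z).
  by rewrite /= /skew_form bR (bT x).
have wC x y : w x y = - w y x by rewrite /= /skew_form opprB.
have w0 x y z : w (mul x y) z = 0.
  have rot u v t : w (mul u v) t = - w (mul v t) u by rewrite wI wC.
  by apply: two0; rewrite [X in X + _]rot rot opprK rot addNr.
have prodV x y : mul x y \in left_radical w.
  by apply/left_radicalP => z; exact: w0.
have NV0 : (left_radical s :&: left_radical w = 0)%VS.
  apply/eqP; rewrite -subv0; apply/subvP => x; rewrite memv_cap memv0.
  case/andP=> /left_radicalP sx0 /left_radicalP wx0.
  apply/eqP/b_ndeg => y; apply: two0.
  have -> : b x y + b x y = s x y + w x y.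
    by rewrite /= /sym_form /skew_form addrACA subrr addr0.
  by rewrite sx0 wx0 addr0.
have [B [BC B_ndeg Bs]] := nondegenerate_completion sC NV0.
exists B; split=> // x y z.
(* Symmetry moves the product [mul y z] to the first argument, where [Bs] applies since products lie
   in the radical of [w]. *)
by rewrite [RHS]BC !Bs // sI sC.
Qed.

(** Non-degeneracy gives injectivity, and a space and its dual have equal dimension. *)
Lemma form_dual_bijective b :
  (forall x, (forall y, b x y = 0) -> x = 0) ->
  bijective (linfun (form_dual b)).
Proof.
move=> b_ndeg; set Phi := linfun _.
have ker0 : lker Phi = 0%VS.
  apply/eqP; rewrite -subv0; apply/subvP => x /left_radicalP bx0.
  by rewrite memv0; apply/eqP/b_ndeg.
have imT : limg Phi = fullv.
  apply/eqP; rewrite eqEdim subvf limg_dim_eq ?ker0 ?capv0 //.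
  by rewrite !dimvf /dim /= muln1.
exists (Phi^-1)%VF; first by apply: lker0_lfunK; rewrite ker0.
by move=> f; rewrite limg_lfunVK // imT memvf.
Qed.

End InvariantForms.

Theorem corollary3p15 (K : fieldType) (charK0 : [pchar K] =i pred0)
    (A : vectType K) (mul : {bilinear A -> A -> A}) :
  (exists B : {bilinear A -> A -> K | *%R & *%R}, quadratic mul B) <->
  bimodule_isomorphic (Rmul mul) (Lmul mul) (Rstar mul) (Lstar mul).
Proof.
split=> [[B [BC B_ndeg BI]] | [Phi [Phi_bij PhiR PhiL]]].
  have BE x y : linfun (form_dual B) x y = B x y by rewrite lfunE form_dualE.
  exists (linfun (form_dual B)); split; first exact: form_dual_bijective.
    move=> x v; apply/lfunP => y.
    by rewrite RstarE comp_lfunE !BE LmulE RmulE.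
  move=> x v; apply/lfunP => y.
  rewrite LstarE comp_lfunE !BE LmulE RmulE.
  (* Compatibility with [R] was invariance itself; for [L], invariance is conjugated by symmetry. *)
  by rewrite BC -BI BC.
have K2 : 2%:R != 0 :> K by rewrite ((pcharf0P K).1 charK0).
(* Injectivity of [Phi] is non-degeneracy of its form; the intertwining relations, evaluated at [z],
   are the two invariances. *)
apply: (@quadratic_of_biinvariant _ _ _ (lfun_form Phi)) => //= [x Phix0||].
- apply: (bij_inj Phi_bij); rewrite linear0; apply/lfunP => y.
  by rewrite zero_lfunE; exact: Phix0.
- move=> x y z; have /lfunP/(_ z) := PhiR y x.
  by rewrite RstarE comp_lfunE LmulE RmulE.
move=> x y z; have /lfunP/(_ z) := PhiL x y.
by rewrite LstarE comp_lfunE LmulE RmulE.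
Qed.
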